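(* Let $p\ge 1$ be an integer, let $X \sim N(0,I_{p})$ be a standard Gaussian random vector in $\mathbb{R}^p$, and let $a_{1},\dots,a_{p} \in \mathbb{S}^{p-1} =\{ x \in \mathbb{R}^{p} : \| x \| = 1 \}$ and $b_{1},\dots,b_{p} \in \mathbb{R}$ be given. Then for every $\delta > 0$, \[ \mathrm{P} \left (a_{j}'X \le b_{j} + \delta \ \text{ for all } 1 \le j \le p \right) - \mathrm{P} \left (a_{j}'X \le b_{j} \ \text{ for all } 1 \le j \le p \right) \le \delta \left(\sqrt{2\log p}+2\right). \]
   Context: $\|\cdot\|$ is the Euclidean norm, $a'x$ denotes the Euclidean inner product of $a,x\in\mathbb{R}^p$, $I_p$ is the $p\times p$ identity matrix, and $\log$ is the natural logarithm. *)

(* Defs.v *)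
From HB Require Import structures.
From mathcomp Require Export all_boot all_order all_algebra.
From mathcomp Require Export all_classical all_reals all_analysis.

Set Implicit Arguments.
Unset Strict Implicit.
Unset Printing Implicit Defensive.

Import Order.TTheory GRing.Theory Num.Theory.
Import numFieldNormedType.Exports.

Local Open Scope classical_set_scope.
Local Open Scope ring_scope.

Definition inner (R : realType) (p : nat) (u v : 'rV[R]_p) : R :=
  \sum_(i < p) u 0 i * v 0 i.

(* The library norm `|u| on 'rV[R]_p is the sup norm, not the Euclidean one. *)
Definition enorm (R : realType) (p : nat) (u : 'rV[R]_p) : R :=
  Num.sqrt (inner u u).

Definition mutually_independent (R : realType) (d : measure_display)
    (T : measurableType d) (P : probability T R) (I : finType)
    (Y : I -> T -> R) : Prop :=
  forall (J : {set I}) (A : I -> set R), (forall i, measurable (A i)) ->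
    P [set t | forall i, i \in J -> A i (Y i t)] =
    (\prod_(i in J) P (Y i @^-1` A i))%E.

(* Equality of laws is required on Borel sets only: the functions [normal_prob]
   and [pushforward] carry no meaning on nonmeasurable sets. *)
Definition standard_normal (R : realType) (d : measure_display)
    (T : measurableType d) (P : probability T R) (Y : T -> R) : Prop :=
  measurable_fun [set: T] Y /\
  forall A : set R, measurable A -> pushforward P Y A = normal_prob 0 1 A.

(* X ~ N(0, I_p): the coordinates of X are i.i.d. standard normal variables. *)
Definition standard_gaussian_vector (R : realType) (d : measure_display)
    (T : measurableType d) (P : probability T R) (p : nat)
    (X : T -> 'rV[R]_p) : Prop :=
  mutually_independent P (fun (i : 'I_p) t => X t 0 i) /\
  forall i : 'I_p, standard_normal P (fun t => X t 0 i).

(* Main.v *)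
From HB Require Import structures.
Require Import Defs.
From mathcomp Require Import measurable_realfun ring lra.
Import Order.TTheory GRing.Theory Num.Theory.
Import numFieldNormedType.Exports.
Local Open Scope classical_set_scope.
Local Open Scope ring_scope.

(** This is Nazarov's inequality. Write Z_j = a_j'X and call W_j = Z_j - b_j the
    excess of the j-th constraint. A point counted on the left violates some
    constraint, but none by more than delta. Sort these points by the index j
    of their largest excess (the least such index in case of ties): the point
    then lies in the cell B_j where W_j is the largest excess, and b_j < Z_j <=
    b_j + delta. The cells are disjoint, and each B_j is stable under the
    translations x |-> x + s a_j with s >= 0, because such a translation raises
    W_j by s and every other W_k by s a_k'a_j <= s.

    Put L = sqrt (2 log p), and split the part of the slab b_j < Z_j <= b_j +
    delta that lies in B_j at the level Z_j = L.

    - Where Z_j <= L ([hazard]): let C be this part. The translates of C by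
      0, delta a_j, 2 delta a_j, ... are disjoint and contained in B_j.
      By the Cameron-Martin formula, translation by s a_j multiplies the
      probability of C by at least exp (- s L - s^2 / 2). Summing, P(B_j) is at
      least P(C) / delta times a Riemann sum of the integral of that function,
      which is a Mills ratio and at least 1 / (L + 1) ([normal_ratio_sum]). So
      P(C) <= delta (L + 1) P(B_j), and the P(B_j) add up to at most 1.

    - Where Z_j > L ([pr_slab]): a slab of width delta on the far side of L >= 0
      is the translate by at least L of the slab 0 < Z_j <= delta, whose
      probability is at most delta ([pr_central_slab]). By Cameron-Martin
      again, the translation costs a factor exp (- L^2 / 2) = 1 / p, so the p
      slabs contribute at most delta in total.

    The sum is delta (L + 1) + delta = delta (L + 2).

    The Cameron-Martin formula ([cameron_martin]) is obtained one coordinate at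
    a time. Independence says that replacing one coordinate by a
    fresh standard normal variable does not change the law ([resample]), so by
    Tonelli translating that coordinate is a one-dimensional matter
    ([cameron_martin1]). *)

Set Implicit Arguments.
Unset Strict Implicit.
Unset Printing Implicit Defensive.

(** * Translation of the one-dimensional standard normal law *)

Section one_dim.
Context {R : realType}.
Local Notation leb := (@lebesgue_measure R).
Local Notation gauss := (@normal_prob R 0 1).

Lemma measurable_addr (c : R) :
  measurable_fun [set: measurableTypeR R]
    (fun x : measurableTypeR R => (x + c : measurableTypeR R)).
Proof. exact: measurable_funD. Qed.

Lemma lebesgue_measure_addr (c : R) (A : set R) : measurable A ->
  pushforward leb
    (fun x : measurableTypeR R => (x + c : measurableTypeR R)) A = leb A.
Proof.
move=> mA; apply/esym/lebesgue_measure_unique => //=.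
  exact: measurable_addr.
move=> _ _ [[a b]] _ <-.
rewrite /pushforward /=.
rewrite (_ : _ @^-1` _ = `]a - c, b - c]%classic); last first.
  by apply/seteqP; split => x /=; rewrite !in_itv /= ltrBlDr lerBrDr.
rewrite !lebesgue_measure_itv/= !lte_fin ltrD2r.
by case: ifP => // _; rewrite -!EFinB; congr EFin; ring.
Qed.

Lemma integral_lebesgue_addr (c : R) (f : R -> \bar R) :
  measurable_fun [set: R] f -> (forall x, 0 <= f x)%E ->
  (\int[leb]_x f (x + c)%R = \int[leb]_x f x)%E.
Proof.
move=> mf f0.
rewrite -[in LHS](preimage_setT
  (fun x : measurableTypeR R => (x + c : measurableTypeR R))).
rewrite -(ge0_integral_pushforward (measurable_addr c))//=.
apply: eq_measure_integral => [|? A mA _]; first exact: measurable_addr.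
exact: lebesgue_measure_addr.
Qed.

(** [normal_prob] is defined by its density on sets only; the extension to
    integrands goes through uniqueness of the Radon-Nikodym derivative. *)
Lemma integral_normal_prob_density (f : R -> \bar R) :
  measurable_fun [set: R] f -> (forall x, 0 <= f x)%E ->
  (\int[gauss]_x f x = \int[leb]_x (f x * (normal_pdf 0 1 x)%:E))%E.
Proof.
move=> mf f0.
have dom := normal_prob_dominates (0 : R) (1 : R).
rewrite -(Radon_Nikodym_SigmaFinite.change_of_variables dom)//=.
apply: ae_eq_integral => //=.
- apply: emeasurable_funM => //; apply: measurable_int.
  exact: Radon_Nikodym_SigmaFinite.f_integrable.
- apply: emeasurable_funM => //; apply/measurable_EFinP.
  exact: measurable_normal_pdf.
- apply: ae_eqe_mul2l; apply: integral_ae_eq => //=.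
  + exact: Radon_Nikodym_SigmaFinite.f_integrable.
  + by apply/measurable_EFinP; exact: measurable_normal_pdf.
  + by move=> A _ mA; rewrite -Radon_Nikodym_SigmaFinite.f_integral.
Qed.

Lemma normal_pdf_shift (c x : R) :
  normal_pdf 0 1 (x - c) = expR (c * x - c ^+ 2 / 2) * normal_pdf 0 1 x.
Proof.
rewrite !normal_pdfE ?oner_eq0// mulrCA /normal_fun -expRD.
by congr (_ * expR _); rewrite expr1n; field.
Qed.

(** The weight is the density of N(c, 1) with respect to N(0, 1). *)
Lemma cameron_martin1 (c : R) (f : R -> \bar R) :
  measurable_fun [set: R] f -> (forall x, 0 <= f x)%E ->
  (\int[gauss]_x f (x + c)%R =
   \int[gauss]_x (f x * (expR (c * x - c ^+ 2 / 2))%:E))%E.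
Proof.
move=> mf f0.
have mw : measurable_fun [set: R] (fun x => (expR (c * x - c ^+ 2 / 2))%:E).
  apply/measurable_EFinP; apply: measurableT_comp => //=.
  by apply: measurable_funB => //; exact: measurable_funM.
rewrite integral_normal_prob_density//; last first.
  by apply: (measurableT_comp mf); exact: measurable_addr.
rewrite integral_normal_prob_density//; first last.
- by move=> x; rewrite mule_ge0 ?lee_fin ?expR_ge0.
- exact: emeasurable_funM.
rewrite -[RHS](integral_lebesgue_addr c); first last.
- by move=> x; rewrite !mule_ge0 ?lee_fin ?expR_ge0 ?normal_pdf_ge0.
- apply: emeasurable_funM => //; first exact: emeasurable_funM.
  by apply/measurable_EFinP; exact: measurable_normal_pdf.
apply: eq_integral => x _; rewrite -muleA; congr (_ * _)%E.
by rewrite -EFinM -normal_pdf_shift addrK.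
Qed.

End one_dim.

(** * Translation of a standard Gaussian vector *)

Section tuples.
Context {R : realType} {p : nat}.
Implicit Types (x : p.-tuple R) (v : 'rV[R]_p).

Definition rect (A : 'I_p -> set R) : set (p.-tuple R) :=
  [set x | forall i, A i (tnth x i)].

Definition update (i : 'I_p) (r : R) x : p.-tuple R :=
  [tuple if k == i then r else tnth x k | k < p].

Definition shift v x : p.-tuple R := [tuple tnth x k + v 0 k | k < p].

Definition lin v x : R := \sum_(k < p) v 0 k * tnth x k.

Lemma tnth_update i r x k :
  tnth (update i r x) k = if k == i then r else tnth x k.
Proof. by rewrite tnth_mktuple. Qed.

Lemma tnth_shift v x k : tnth (shift v x) k = tnth x k + v 0 k.
Proof. by rewrite tnth_mktuple. Qed.

Lemma shift0 x : shift 0 x = x.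
Proof. by apply: eq_from_tnth => i; rewrite !tnth_shift mxE addr0. Qed.

Lemma measurable_rect (A : 'I_p -> set R) : (forall i, measurable (A i)) ->
  measurable (rect A).
Proof.
move=> mA; rewrite (_ : rect A = \bigcap_(i in [set: 'I_p])
    ((fun x : p.-tuple R => tnth x i) @^-1` A i)); last first.
  by apply/seteqP; split => x /= xA i; [move=> _|]; apply: xA.
apply: fin_bigcap_measurable => // i _.
rewrite -[X in measurable X]setTI; exact: measurable_tnth.
Qed.

Lemma measurable_update i : measurable_fun [set: R * p.-tuple R]
  (fun z => update i z.1 z.2).
Proof.
apply/measurable_fun_tnthP => k.
rewrite (_ : _ \o _ = fun z => if k == i then z.1 else tnth z.2 k); last first.
  by apply/funext => z /=; rewrite tnth_update.
case: eqP => _; first exact: measurable_fst.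
by apply: (measurableT_comp (measurable_tnth k)); exact: measurable_snd.
Qed.

Lemma measurable_translate i (c : R) : measurable_fun [set: p.-tuple R]
  (fun x => update i (tnth x i + c) x).
Proof.
have h : measurable_fun setT (fun x : p.-tuple R => (tnth x i + c, x)).
  apply/measurable_fun_pairP; split; last exact: measurable_id.
  by apply: measurable_funD => //; exact: measurable_tnth.
exact: (measurableT_comp (measurable_update i) h).
Qed.

Lemma measurable_shift v : measurable_fun [set: p.-tuple R] (shift v).
Proof.
apply/measurable_fun_tnthP => k.
rewrite (_ : _ \o _ = fun x => tnth x k + v 0 k); last first.
  by apply/funext => z /=; rewrite tnth_shift.
by apply: measurable_funD => //; exact: measurable_tnth.
Qed.

Lemma measurable_lin v : measurable_fun [set: p.-tuple R] (lin v).
Proof.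
apply: measurable_sum => k; apply: measurable_funM => //.
exact: measurable_tnth.
Qed.

(** Rectangles, unlike the cylinders that generate the product sigma-algebra,
    are stable under intersection: two finite measures that agree on them are
    equal. *)
Lemma tuple_measurableE :
  @measurable _ (p.-tuple R) =
  <<s [set rect A | A in [set A | forall i, measurable (A i)]] >>.
Proof.
apply/seteqP; split; last first.
  apply: smallest_sub; first exact: sigma_algebra_measurable.
  by move=> _ [A mA <-]; exact: measurable_rect.
apply: smallest_sub; first exact: smallest_sigma_algebra.
rewrite -bigcup_seq; apply: bigcup_sub => i _ _ [B mB <-].
apply: sub_sigma_algebra => /=.
exists (fun k => if k == i then B else setT) => /=.
  by move=> k; case: ifP.
apply/seteqP; split => x /=.
  by move=> /(_ i); rewrite eqxx.
by move=> [_ Bx] k; case: eqP => // ->.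
Qed.

(** This is the standard Gaussian law on tuples; it is characterised by its
    values on rectangles because they form a generating pi-system. *)
Definition gaussian_rect (mu : set (p.-tuple R) -> \bar R) :=
  forall A : 'I_p -> set R, (forall i, measurable (A i)) ->
    mu (rect A) = (\prod_(i < p) @normal_prob R 0 1 (A i))%E.

Section cameron_martin.
Variable mu : probability (p.-tuple R) R.
Hypothesis muE : gaussian_rect mu.
Local Notation gauss := (@normal_prob R 0 1).

(** This is how independence enters: coordinate [i] may be drawn afresh,
    independently of all the others. The two laws agree on rectangles, where
    both equal the product of the marginals. *)
Lemma resample i (E : set (p.-tuple R)) : measurable E ->
  pushforward (gauss \x mu)%E (fun z => update i z.1 z.2) E = mu E.
Proof.
move=> mE.
set G := [set rect A | A in [set A | forall i, measurable (A i)]].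
apply: (measure_unique G (fun=> setT)) => //.
- exact: tuple_measurableE.
- move=> _ _ [A mA <-] [B mB <-]; exists (fun k => A k `&` B k).
    by move=> k; exact: measurableI.
  apply/seteqP; split => x /=; first by move=> AB; split => k; case: (AB k).
  by move=> [Ax Bx] k; split.
- by move=> _; exists (fun=> setT) => //; apply/seteqP; split.
- by rewrite bigcup_const.
- exact: measurable_update.
- move=> mupd _ [A mA <-]; rewrite [LHS]/= /pushforward.
  set A' := fun k => if k == i then setT else A k.
  rewrite (_ : _ @^-1` _ = A i `*` rect A'); last first.
    apply/seteqP; split => -[r x] /=.
      move=> Ax; split => [|k].
        by have := Ax i; rewrite tnth_update eqxx.
      by have := Ax k; rewrite tnth_update /A'; case: eqP.
    move=> [Ar Ax] k; have := Ax k; rewrite tnth_update /A'.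
    by case: eqP => [->|].
  have mA' k : measurable (A' k) by rewrite /A'; case: ifP.
  rewrite product_measure1E; [|exact: mA|exact: measurable_rect].
  rewrite [X in (_ * X)%E](muE mA') [RHS](muE mA).
  rewrite [RHS](bigD1 i)//= (bigD1 i)//=.
  rewrite {1}/A' eqxx probability_setT mul1e; congr (_ * _)%E.
  by apply: eq_bigr => k ki; rewrite /A' (negbTE ki).
- move=> mupd _; rewrite [ltLHS]/= /pushforward preimage_setT -setXTT.
  rewrite product_measure1E// [X in (X * _)%E]probability_setT mul1e.
  by rewrite [ltLHS]probability_setT ltry.
Qed.

(** After resampling coordinate [i], Tonelli isolates the integral over that
    coordinate, and the one-dimensional formula applies with the others
    fixed. *)
Lemma cameron_martin_coord i (c : R) (f : p.-tuple R -> \bar R) :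
  measurable_fun setT f -> (forall x, 0 <= f x)%E ->
  (\int[mu]_x f (update i (tnth x i + c) x) =
   \int[mu]_x (f x * (expR (c * tnth x i - c ^+ 2 / 2))%:E))%E.
Proof.
move=> mf f0.
have res (g : p.-tuple R -> \bar R) : measurable_fun setT g ->
    (forall x, 0 <= g x)%E ->
    (\int[mu]_x g x = \int[mu]_x \int[gauss]_r g (update i r x))%E.
  move=> mg g0.
  rewrite -(@fubini_tonelli2 _ _ _ _ _ gauss mu
    (fun z => g (update i z.1 z.2)))//; last first.
    exact: (measurableT_comp mg (measurable_update i)).
  transitivity (\int[pushforward (gauss \x mu)%E
    (fun z => update i z.1 z.2)]_x g x)%E.
    apply: eq_measure_integral => [|? A mA _]; first exact: measurable_update.
    exact/esym/resample.
  rewrite ge0_integral_pushforward//.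
  exact: measurable_update.
have mu1 := measurable_translate i c.
have mw : measurable_fun setT
    (fun x : p.-tuple R => (expR (c * tnth x i - c ^+ 2 / 2))%:E).
  apply/measurable_EFinP; apply: measurableT_comp => //=.
  apply: measurable_funB => //; apply: measurable_funM => //.
  exact: measurable_tnth.
rewrite res//; last exact: (measurableT_comp mf mu1).
rewrite [RHS]res; first last.
- by move=> x; rewrite mule_ge0 ?lee_fin ?expR_ge0.
- exact: emeasurable_funM.
apply: eq_integral => x _.
have mr : measurable_fun setT (fun r : R => f (update i r x)).
  apply: (measurableT_comp mf).
  have h : measurable_fun setT (fun r : R => (r, x)) by exact: pair2_measurable.
  exact: (measurableT_comp (measurable_update i) h).
transitivity (\int[gauss]_r (f (update i (r + c)%R x)))%E.
  apply: eq_integral => r _; congr f; apply: eq_from_tnth => k.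
  by rewrite !tnth_update eqxx; case: eqP.
apply: (etrans (cameron_martin1 c mr (fun r => f0 _))).
apply: eq_integral => r _.
by rewrite tnth_update eqxx.
Qed.

(** The coordinates of [v] are added one at a time. Each step multiplies the
    integrand by the weight of one coordinate, and the weights already
    collected do not see the new one. *)
Lemma cameron_martin v (f : p.-tuple R -> \bar R) :
  measurable_fun setT f -> (forall x, 0 <= f x)%E ->
  (\int[mu]_x f (shift v x) =
   \int[mu]_x (f x * (expR (lin v x - inner v v / 2))%:E))%E.
Proof.
move=> mf f0.
(* tr n keeps the first n coordinates of v. *)
pose tr n : 'rV[R]_p := \row_k (if (k < n)%N then v 0 k else 0).
have trp : tr p = v by apply/rowP => k; rewrite mxE ltn_ord.
have trS n (np : (n < p)%N) k : tr n.+1 0 k =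
    tr n 0 k + (if k == Ordinal np then v 0 k else 0).
  rewrite !mxE -val_eqE /= ltnS leq_eqVlt.
  by case: ltngtP => // _; rewrite ?addr0 ?add0r.
have tr_i n (np : (n < p)%N) : tr n 0 (Ordinal np) = 0 by rewrite mxE /= ltnn.
have linS n (np : (n < p)%N) x :
    lin (tr n.+1) x = lin (tr n) x + v 0 (Ordinal np) * tnth x (Ordinal np).
  rewrite /lin; under eq_bigr do rewrite trS mulrDl; rewrite big_split /=.
  congr (_ + _); rewrite (bigD1 (Ordinal np))//= eqxx big1 ?addr0// => k kn.
  by rewrite (negbTE kn) mul0r.
have innerS n (np : (n < p)%N) : inner (tr n.+1) (tr n.+1) =
    inner (tr n) (tr n) + v 0 (Ordinal np) ^+ 2.
  rewrite /inner (bigD1 (Ordinal np))//= [in RHS](bigD1 (Ordinal np))//=.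
  rewrite !trS eqxx !tr_i !add0r mul0r add0r addrC; congr (_ + _).
  by apply: eq_bigr => k kn; rewrite !trS (negbTE kn) addr0.
suff main n : (n <= p)%N -> forall f : p.-tuple R -> \bar R,
    measurable_fun setT f -> (forall x, 0 <= f x)%E ->
    (\int[mu]_x f (shift (tr n) x) =
     \int[mu]_x (f x *
       (expR (lin (tr n) x - inner (tr n) (tr n) / 2))%:E))%E.
  by have := main p (leqnn _) f mf f0; rewrite trp.
elim: n => [_|n IH np] {mf f0}f mf f0.
  have t0 : tr 0%N = 0 by apply/rowP => k; rewrite !mxE.
  apply: eq_integral => x _; rewrite t0 shift0.
  by rewrite /lin /inner !big1 ?mul0r ?subrr ?expR0 ?mule1// => k _;
    rewrite mxE mul0r.
set i := Ordinal np.
have mw : measurable_fun setT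
    (fun x => (expR (lin (tr n) x - inner (tr n) (tr n) / 2))%:E).
  apply/measurable_EFinP; apply: measurableT_comp => //=.
  by apply: measurable_funB => //; exact: measurable_lin.
transitivity (\int[mu]_x
    (f \o (fun y => update i (tnth y i + v 0 i)%R y)) (shift (tr n) x))%E.
  apply: eq_integral => x _ /=; congr f; apply: eq_from_tnth => k.
  rewrite tnth_shift tnth_update !tnth_shift trS -/i addrA.
  by case: eqP => [->|]; rewrite ?addr0.
rewrite IH; [|exact: ltnW| |by move=> x; exact: f0]; last first.
  exact: (measurableT_comp mf (measurable_translate i (v 0 i))).
have lin_update r x : lin (tr n) (update i r x) = lin (tr n) x.
  apply: eq_bigr => k _; rewrite tnth_update.
  by case: eqP => // ->; rewrite tr_i !mul0r.
pose g y := (f y * (expR (lin (tr n) y - inner (tr n) (tr n) / 2))%:E)%E.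
transitivity (\int[mu]_x g (update i (tnth x i + v 0 i)%R x))%E.
  by apply: eq_integral => x _; rewrite /g lin_update.
rewrite cameron_martin_coord; first last.
- by move=> x; rewrite mule_ge0 ?lee_fin ?expR_ge0.
- exact: emeasurable_funM.
apply: eq_integral => x _; rewrite -muleA -EFinM -expRD linS innerS.
by congr (_ * (expR _)%:E)%E; rewrite -/i; field.
Qed.

End cameron_martin.
End tuples.

(** * A discrete lower bound on the Mills ratio *)

Section mills.
Context {R : realType}.
Implicit Types m d s : R.

(** With phi the standard normal density, this is phi (m + s) / phi m: its
    integral over s >= 0 is the Mills ratio (1 - Phi m) / phi m. *)
Definition normal_ratio m s : R := expR (- (s * m) - s ^+ 2 / 2).

(** With f = [normal_ratio m], this is a finite-difference form of the
    inequality - (f(s) / (m + s + 1))' <= f(s) behind the lower bound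
    1 / (m + 1) on the Mills ratio. It reduces to 1 + y <= exp y. *)
Lemma normal_ratio_step m d s : 0 <= m -> 0 <= d -> 0 <= s ->
  normal_ratio m s / (m + s + 1) - normal_ratio m (s + d) / (m + (s + d) + 1)
    <= d * normal_ratio m s.
Proof.
move=> m0 d0 s0; set u := m + s.
have u0 : 0 <= u by rewrite addr_ge0.
have -> : normal_ratio m (s + d) =
    normal_ratio m s * expR (- (d * u) - d ^+ 2 / 2).
  by rewrite -expRD; congr expR; rewrite /u; field.
rewrite -mulrA -mulrBr mulrC ler_wpM2r ?expR_ge0//.
(* With 1 + y in place of e = exp y, clearing denominators leaves
   d (u + 1) (1 + d / 2) >= d. *)
have := expR_ge1Dx (- (d * u) - d ^+ 2 / 2); set e := expR _ => he.
rewrite (_ : m + (s + d) + 1 = u + d + 1); last by rewrite /u; ring.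
rewrite -[leRHS](@mulfK _ ((u + 1) * (u + d + 1))); last first.
  by rewrite mulf_neq0// gt_eqF//; lra.
rewrite (_ : _ - _ =
    ((u + d + 1) - (u + 1) * e) / ((u + 1) * (u + d + 1))); last first.
  by field; apply/andP; split; rewrite gt_eqF//; lra.
rewrite ler_pM2r ?invr_gt0 ?mulr_gt0//; [|lra|lra].
have : (u + 1) * (1 + (- (d * u) - d ^+ 2 / 2)) <= (u + 1) * e.
  by apply: ler_wpM2l => //; lra.
have : 0 <= d * d by exact: mulr_ge0.
have : 0 <= d * u by exact: mulr_ge0.
have : 0 <= d * d * u by rewrite !mulr_ge0.
nra.
Qed.

(** Telescoping [normal_ratio_step]. As n grows, the left side tends to the
    lower bound 1 / (m + 1) of the Mills ratio. *)
Lemma normal_ratio_sum m d n : 0 <= m -> 0 <= d ->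
  (m + 1)^-1 - (1 + n%:R * d)^-1 <=
  d * \sum_(k < n) normal_ratio m (k%:R * d).
Proof.
move=> m0 d0.
have tele : normal_ratio m 0 / (m + 0 + 1) -
    normal_ratio m (n%:R * d) / (m + n%:R * d + 1) <=
    d * \sum_(k < n) normal_ratio m (k%:R * d).
  elim: n => [|n IH]; first by rewrite big_ord0 mulr0 mul0r subrr.
  rewrite big_ord_recr /= mulrDr.
  have := @normal_ratio_step m d (n%:R * d) m0 d0 (mulr_ge0 (ler0n _ _) d0).
  rewrite (_ : n%:R * d + d = n.+1%:R * d); last by rewrite -natr1; ring.
  lra.
apply: le_trans tele.
have nd0 : 0 <= n%:R * d by rewrite mulr_ge0.
rewrite {1}/normal_ratio mul0r expr0n/= mul0r oppr0 addr0 expR0 div1r addr0.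
apply: lerB => //.
rewrite -[leRHS]mul1r; apply: ler_pM; rewrite ?expR_ge0 ?invr_ge0//.
- lra.
- rewrite -[leRHS]expR0 ler_expR.
  have : 0 <= n%:R * d * m by rewrite mulr_ge0.
  have : 0 <= (n%:R * d) ^+ 2 by rewrite sqr_ge0.
  lra.
- by rewrite lef_pV2 ?posrE; lra.
Qed.

Lemma le_limit_harmonic (d x y : R) : 0 < d ->
  (forall n, x <= y + (1 + n%:R * d)^-1) -> x <= y.
Proof.
move=> d0 h; apply/ler_addgt0Pr => e e0.
apply: (le_trans (h (Num.bound (e * d)^-1))); rewrite lerD2l.
have b0 : 0 < (e * d)^-1 by rewrite invr_gt0 mulr_gt0.
have := archi_boundP (ltW b0); set N := _%:R => hN.
have N0 : 0 <= N * d by rewrite mulr_ge0 ?ler0n// ltW.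
rewrite -[leLHS]mul1r ler_pdivrMr; last lra.
have : 1 < N * (e * d) by rewrite -ltr_pdivrMr ?mulr_gt0// div1r.
rewrite mulrDr mulr1 (mulrCA N) => h1; lra.
Qed.

End mills.

(** * Real-valued probabilities *)

Section real_probability.
Context d (T : measurableType d) (R : realType) (mu : probability T R).
Implicit Types A B : set T.

Definition pr A : R := fine (mu A).

Lemma EFin_pr A : measurable A -> mu A = (pr A)%:E.
Proof. by move=> mA; rewrite fineK ?fin_num_measure. Qed.

Lemma pr_ge0 A : 0 <= pr A.
Proof. by rewrite fine_ge0. Qed.

Lemma pr_le1 A : measurable A -> pr A <= 1.
Proof. by move=> mA; rewrite -lee_fin -EFin_pr// probability_le1. Qed.

Lemma le_pr A B : measurable A -> measurable B -> A `<=` B -> pr A <= pr B.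
Proof.
by move=> mA mB AB; rewrite -lee_fin -!EFin_pr// le_measure ?inE.
Qed.

Lemma pr_bigsetU n (F : 'I_n -> set T) : (forall i, measurable (F i)) ->
  trivIset setT F -> pr (\big[setU/set0]_(i < n) F i) = \sum_(i < n) pr (F i).
Proof.
move=> mF tF; apply: EFin_inj; rewrite -EFin_pr; last exact: bigsetU_measurable.
rewrite measure_bigsetU_ord// -sumEFin.
by apply: eq_bigr => i _; exact: EFin_pr.
Qed.

Lemma sum_pr_le n (F : 'I_n -> set T) B : (forall i, measurable (F i)) ->
  measurable B -> trivIset setT F -> (forall i, F i `<=` B) ->
  \sum_(i < n) pr (F i) <= pr B.
Proof.
move=> mF mB tF FB; rewrite -pr_bigsetU//; apply: le_pr => //.
  exact: bigsetU_measurable.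
rewrite -bigcup_seq => x [i _]; exact: FB.
Qed.

Lemma pr_le_sum n (F : 'I_n -> set T) A : (forall i, measurable (F i)) ->
  measurable A -> trivIset setT F -> (forall x, A x -> exists i, F i x) ->
  pr A <= \sum_(i < n) pr (F i).
Proof.
move=> mF mA tF AF; rewrite -pr_bigsetU//; apply: le_pr => //.
  exact: bigsetU_measurable.
by rewrite -bigcup_seq => x /AF[i Fx]; exists i => //=; rewrite mem_index_enum.
Qed.

Lemma prDI A B : measurable A -> measurable B ->
  pr A = pr (A `\` B) + pr (A `&` B).
Proof.
move=> mA mB; apply: EFin_inj; rewrite EFinD -!EFin_pr//.
- exact: measureDI.
- exact: measurableI.
- exact: measurableD.
Qed.

End real_probability.

(** * Probabilities of half-spaces and slabs *)

Section inner_products.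
Context {R : realType} {p : nat}.
Implicit Types (x : p.-tuple R) (u v : 'rV[R]_p).

Lemma innerC u v : inner u v = inner v u.
Proof. by apply: eq_bigr => i _; rewrite mulrC. Qed.

Lemma innerZl (c : R) u v : inner (c *: u) v = c * inner u v.
Proof.
by rewrite /inner mulr_sumr; apply: eq_bigr => i _; rewrite mxE mulrA.
Qed.

Lemma innerZr (c : R) u v : inner u (c *: v) = c * inner u v.
Proof. by rewrite innerC innerZl innerC. Qed.

Lemma linZ (c : R) v x : lin (c *: v) x = c * lin v x.
Proof. by rewrite /lin mulr_sumr; apply: eq_bigr => i _; rewrite mxE mulrA. Qed.

Lemma linB u v x : lin (u - v) x = lin u x - lin v x.
Proof. by rewrite -sumrB; apply: eq_bigr => i _; rewrite !mxE mulrBl. Qed.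

Lemma lin_shift u v x : lin u (shift v x) = lin u x + inner u v.
Proof.
by rewrite -big_split; apply: eq_bigr => i _ /=; rewrite tnth_shift mulrDr.
Qed.

Lemma shiftD u v x : shift u (shift v x) = shift (v + u) x.
Proof. by apply: eq_from_tnth => i; rewrite !tnth_shift mxE addrA. Qed.

Lemma enorm1_inner u : enorm u = 1 -> inner u u = 1.
Proof.
rewrite /enorm => h; rewrite -[LHS]sqr_sqrtr ?h ?expr1n//.
by apply: sumr_ge0 => i _; rewrite -expr2 sqr_ge0.
Qed.

Lemma inner_le1 u v : inner u u = 1 -> inner v v = 1 -> inner u v <= 1.
Proof.
move=> u1 v1.
have : 0 <= \sum_(i < p) (u 0 i - v 0 i) ^+ 2.
  by apply: sumr_ge0 => i _; rewrite sqr_ge0.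
rewrite (_ : \sum_(i < p) _ = inner u u + inner v v - 2 * inner u v).
  by rewrite u1 v1; lra.
rewrite /inner mulr_sumr -big_split -sumrB; apply: eq_bigr => i _ /=; ring.
Qed.

End inner_products.

Section gaussian_slabs.
Context {R : realType} {p : nat}.
Variable mu : probability (p.-tuple R) R.
Hypothesis muE : gaussian_rect mu.
Implicit Types (x : p.-tuple R) (u v : 'rV[R]_p) (B C : set (p.-tuple R)).

Lemma measurable_preimage_shift v C :
  measurable C -> measurable (shift v @^-1` C).
Proof.
by move=> mC; rewrite -[X in measurable X]setTI; exact: measurable_shift.
Qed.

Lemma measurable_lin_ge c u : measurable [set x : p.-tuple R | c <= lin u x].
Proof.
rewrite (_ : [set x | _] = lin u @^-1` `[c, +oo[).
  by rewrite -[X in measurable X]setTI; exact: measurable_lin.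
by apply/seteqP; split => x /=; rewrite in_itv/= andbT.
Qed.

Lemma measurable_lin_gt c u : measurable [set x : p.-tuple R | c < lin u x].
Proof.
rewrite (_ : [set x | _] = lin u @^-1` `]c, +oo[).
  by rewrite -[X in measurable X]setTI; exact: measurable_lin.
by apply/seteqP; split => x /=; rewrite in_itv/= andbT.
Qed.

Lemma measurable_lin_le c u : measurable [set x : p.-tuple R | lin u x <= c].
Proof.
rewrite (_ : [set x | _] = lin u @^-1` `]-oo, c]).
  by rewrite -[X in measurable X]setTI; exact: measurable_lin.
by apply/seteqP; split => x /=; rewrite in_itv.
Qed.

Definition slab u c d := [set x : p.-tuple R | c < lin u x <= c + d].

Lemma slabE u c d :
  slab u c d = [set x | c < lin u x] `&` [set x | lin u x <= c + d].
Proof.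
by apply/seteqP; split => x /=; [move/andP|move=> h; apply/andP].
Qed.

Lemma measurable_slab u c d : measurable (slab u c d).
Proof.
rewrite slabE; apply: measurableI.
  exact: measurable_lin_gt.
exact: measurable_lin_le.
Qed.

(** [shift v @^-1` C] is the translate of [C] by [- v]. *)
Lemma mu_shift v C : measurable C ->
  mu (shift v @^-1` C) =
  (\int[mu]_(x in C) (expR (lin v x - inner v v / 2))%:E)%E.
Proof.
move=> mC.
rewrite -[LHS]mul1e -(integral_cst _ (measurable_preimage_shift v mC)).
rewrite [LHS]integral_mkcond [RHS]integral_mkcond.
transitivity (\int[mu]_x (\1_C (shift v x))%:E)%E.
  apply: eq_integral => x _; rewrite patchE indicE.
  by rewrite (_ : (x \in _) = (shift v x \in C)) //; case: ifP.
rewrite (cameron_martin muE v (f := fun x => (\1_C x)%:E))//.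
  apply: eq_integral => x _; rewrite patchE indicE.
  by case: ifP => _; rewrite ?mul1e ?mul0e.
by apply/measurable_EFinP; exact: measurable_indic.
Qed.

Lemma measurable_density v D :
  measurable_fun D (fun x : p.-tuple R => (expR (lin v x - inner v v / 2))%:E).
Proof.
apply: measurable_funTS; apply/measurable_EFinP; apply: measurableT_comp => //=.
by apply: measurable_funB => //; exact: measurable_lin.
Qed.

Lemma pr_shift_ge v C l : measurable C -> 0 <= l ->
  (forall x, C x -> l <= expR (lin v x - inner v v / 2)) ->
  l * pr mu C <= pr mu (shift v @^-1` C).
Proof.
move=> mC l0 hl; rewrite -lee_fin EFinM -!EFin_pr//; last first.
  exact: measurable_preimage_shift.
rewrite mu_shift// -integral_cst//; apply: ge0_le_integral => //.
exact: measurable_density.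
Qed.

Lemma pr_shift_le v C l : measurable C ->
  (forall x, C x -> expR (lin v x - inner v v / 2) <= l) ->
  pr mu (shift v @^-1` C) <= l * pr mu C.
Proof.
move=> mC hl; rewrite -lee_fin EFinM -!EFin_pr//; last first.
  exact: measurable_preimage_shift.
rewrite mu_shift// -integral_cst//; apply: ge0_le_integral => //.
exact: measurable_density.
Qed.

(** The two weights are exp (- v'v / 2) times exp (v'x) and exp (- v'x), whose
    sum is 2 cosh (v'x) >= 2, wherever [x] lies. *)
Lemma pr_shift_both_ge v C : measurable C ->
  2 * expR (- (inner v v / 2)) * pr mu C <=
  pr mu (shift v @^-1` C) + pr mu (shift (- v) @^-1` C).
Proof.
move=> mC; rewrite -lee_fin EFinM EFinD -!EFin_pr//;
  try exact: measurable_preimage_shift.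
have linN x : lin (- v) x = - lin v x by rewrite -scaleN1r linZ mulN1r.
have innerN : inner (- v) (- v) = inner v v.
  by rewrite -scaleN1r innerZl innerZr !mulN1r opprK.
rewrite !mu_shift// -integral_cst// -ge0_integralD//;
  [|exact: measurable_density..].
apply: ge0_le_integral => //.
- by move=> x _; rewrite lee_fin mulr_ge0 ?expR_ge0.
- by apply: emeasurable_funD; exact: measurable_density.
- move=> x _; rewrite -EFinD lee_fin linN innerN.
  rewrite ![_ - inner v v / 2]addrC !expRD -mulrDr mulrC ler_wpM2l ?expR_ge0//.
  have := expR_ge1Dx (lin v x); have := expR_ge1Dx (- lin v x); lra.
Qed.

(** The translates of [C] by multiples of [d *: u] stay in [B], and they are
    disjoint because the width of [C] in direction [u] is less than [d]. The
    width is a condition on differences so that it allows either side of the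
    slab to be closed, and hence both [u] and [- u]. *)
Lemma sum_shift_slab u d B C n :
  measurable B -> measurable C -> inner u u = 1 ->
  (forall x s, 0 <= s -> B x -> B (shift (s *: u) x)) -> C `<=` B ->
  (forall x y, C x -> C y -> lin u x - lin u y < d) ->
  \sum_(k < n) pr mu (shift (- (k%:R * d) *: u) @^-1` C) <= pr mu B.
Proof.
move=> mB mC u1 upB CB slabC; apply: sum_pr_le => //.
- by move=> i; exact: measurable_preimage_shift.
- apply/trivIsetP => i j _ _; wlog ij : i j / (i < j)%N.
    move=> h ne; have [ij|ji|ij] := ltngtP i j; first exact: h.
      by rewrite setIC; apply: h => //; rewrite eq_sym.
    by case/eqP: ne; exact: val_inj.
  move=> _; rewrite -subset0 => x [/= Ci Cj].
  have := slabC _ _ Ci Cj; rewrite !lin_shift !innerZr u1 !mulr1.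
  have d0 : 0 < d by have := slabC _ _ Ci Ci; rewrite subrr.
  have : i%:R * d + d <= j%:R * d.
    by rewrite -[X in _ + X]mul1r -mulrDl natr1 ler_pM2r// ler_nat.
  lra.
- move=> i x /= Cx.
  have d0 : 0 < d by have := slabC _ _ Cx Cx; rewrite subrr.
  have := upB _ (i%:R * d) _ (CB _ Cx).
  rewrite shiftD -scalerDl addNr scale0r shift0; apply.
  by rewrite mulr_ge0// ltW.
Qed.

(** A hazard rate bound: below level [m], the mass per unit length in direction
    [u] is at most m + 1 times the mass of an up-closed set. The translates of
    [C] by k d u lie in [B], are disjoint, and by Cameron-Martin have mass at
    least [normal_ratio m (k d)] times that of [C]; the Riemann sum bound then
    applies, in the limit of infinitely many translates. *)
Lemma hazard u d m B C :
  measurable B -> measurable C -> inner u u = 1 -> 0 < d -> 0 <= m ->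
  (forall x s, 0 <= s -> B x -> B (shift (s *: u) x)) -> C `<=` B ->
  (forall x y, C x -> C y -> lin u x - lin u y < d) ->
  (forall x, C x -> lin u x <= m) ->
  pr mu C <= d * (m + 1) * pr mu B.
Proof.
move=> mB mC u1 d0 m0 upB CB slabC Cm.
have C0 := pr_ge0 mu C; have C1 := pr_le1 mu mC.
have step n : pr mu C * ((m + 1)^-1 - (1 + n%:R * d)^-1) <= d * pr mu B.
  apply: (le_trans (ler_wpM2l C0 (normal_ratio_sum n m0 (ltW d0)))).
  rewrite mulrCA ler_pM2l// mulr_sumr.
  apply: le_trans (sum_shift_slab n mB mC u1 upB CB slabC).
  apply: ler_sum => k _; rewrite mulrC; apply: pr_shift_ge => //.
    exact: expR_ge0.
  move=> x Cx; rewrite /normal_ratio ler_expR linZ innerZl innerZr u1 mulr1.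
  have : k%:R * d * lin u x <= k%:R * d * m.
    by rewrite ler_wpM2l ?Cm// mulr_ge0// ltW.
  lra.
have : pr mu C / (m + 1) <= d * pr mu B.
  apply: (le_limit_harmonic d0) => n; have := step n; rewrite mulrBr.
  have : 0 <= (1 + n%:R * d)^-1.
    by rewrite invr_ge0 addr_ge0// mulr_ge0// ltW.
  set r := _^-1 => r0.
  have : pr mu C * r <= r by rewrite ler_piMl.
  lra.
by rewrite ler_pdivrMr ?ltr_wpDl// mulrAC.
Qed.

(** For d >= 1 there is nothing to prove. Otherwise, translate the slab C both
    ways along [u]. The translates by k d and by - k d together have mass at
    least 2 exp (- (k d)^2 / 2) P(C). Over all k >= 0, the total is at most
    1 + P(C), since only C itself is counted twice. With the Riemann sum bound
    at m = 0 this gives 2 P(C) <= d (1 + P(C)), and hence P(C) <= d. *)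
Lemma pr_central_slab u d : inner u u = 1 -> 0 < d -> pr mu (slab u 0 d) <= d.
Proof.
move=> u1 d0; set C := slab u 0 d.
have mC : measurable C := measurable_slab u 0 d.
have C0 := pr_ge0 mu C; have C1 := pr_le1 mu mC.
have [d1|d1] := leP 1 d; first exact: le_trans d1.
pose U := [set x : p.-tuple R | 0 < lin u x].
pose V := [set x : p.-tuple R | lin u x <= d].
have mU : measurable U := measurable_lin_gt 0 u.
have mV : measurable V := measurable_lin_le d u.
have CE : C = U `&` V by rewrite /C slabE add0r.
(* U contains the forward translates, V the backward ones. *)
have UV : pr mu U + pr mu V = 1 + pr mu C.
  have UT : ~` U `&` V = ~` U.
    apply: setIidl => x /= /negP; rewrite -leNgt => /le_trans; apply.
    exact: ltW.
  rewrite [pr mu V](prDI mu mV mU) setIC -CE setDE setIC UT addrA.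
  congr (_ + _).
  have := prDI mu (@measurableT _ _) mU.
  by rewrite setTI setTD /pr probability_setT /= => ->; rewrite addrC.
have N1 : inner (- u) (- u) = 1.
  by rewrite -scaleN1r innerZl innerZr u1 !mulN1r opprK.
have linN x : lin (- u) x = - lin u x by rewrite -scaleN1r linZ mulN1r.
have fwd n : \sum_(k < n) pr mu (shift (- (k%:R * d) *: u) @^-1` C) <= pr mu U.
  apply: sum_shift_slab => //.
  - move=> x s s0; rewrite /U /= lin_shift innerZr u1 mulr1 => h.
    by rewrite ltr_wpDr.
  - by rewrite CE; exact: subIsetl.
  - by move=> x y /andP[_ +] /andP[+ _]; rewrite add0r; lra.
have bwd n :
    \sum_(k < n) pr mu (shift (- (k%:R * d) *: - u) @^-1` C) <= pr mu V.
  apply: sum_shift_slab => //.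
  - move=> x s s0; rewrite /V /= lin_shift scalerN -scaleNr innerZr u1 mulr1.
    lra.
  - by rewrite CE; exact: subIsetr.
  - by move=> x y; rewrite !linN => /andP[+ _] /andP[_ +]; rewrite add0r; lra.
suff : 2 * pr mu C <= d * (1 + pr mu C).
  have : 0 <= pr mu C * (1 - d) by rewrite mulr_ge0// subr_ge0 ltW.
  lra.
suff step n : pr mu C * (1 - (1 + n%:R * d)^-1) <= d * (1 + pr mu C) / 2.
  suff : pr mu C <= d * (1 + pr mu C) / 2 by lra.
  apply: (le_limit_harmonic d0) => n; have := step n; rewrite mulrBr mulr1.
  have : 0 <= (1 + n%:R * d)^-1.
    by rewrite invr_ge0 addr_ge0// mulr_ge0// ltW.
  set r := _^-1 => r0.
  have : pr mu C * r <= r by rewrite ler_piMl.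
  lra.
have := normal_ratio_sum n (lexx 0) (ltW d0); rewrite add0r invr1.
move=> /(ler_wpM2l C0)/le_trans; apply.
rewrite mulrCA -mulrA ler_pM2l// mulr_sumr ler_pdivlMr//.
rewrite -UV; apply: le_trans (lerD (fwd n) (bwd n)).
rewrite -big_split mulr_suml; apply: ler_sum => k _ /=.
rewrite scalerN; apply: le_trans (pr_shift_both_ge _ mC).
rewrite innerZl innerZr u1 /normal_ratio.
set e := expR _; set e' := expR _; have -> : e = e'; last by lra.
by congr expR; ring.
Qed.

(** The slab is the central one translated by [c *: u], and on the central slab
    the Cameron-Martin weight exp (- c u'x - c^2 / 2) is at most
    exp (- c^2 / 2). *)
Lemma pr_slab u c d : inner u u = 1 -> 0 < d -> 0 <= c ->
  pr mu (slab u c d) <= expR (- (c ^+ 2 / 2)) * d.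
Proof.
move=> u1 d0 c0.
have -> : slab u c d = shift (- c *: u) @^-1` slab u 0 d.
  apply/seteqP; split => x; rewrite /slab /= lin_shift innerZr u1 mulr1.
    by move=> /andP[? ?]; apply/andP; split; lra.
  by move=> /andP[? ?]; apply/andP; split; lra.
apply: (@le_trans _ _ (expR (- (c ^+ 2 / 2)) * pr mu (slab u 0 d))); last first.
  by rewrite ler_wpM2l ?expR_ge0// pr_central_slab.
apply: pr_shift_le; first exact: measurable_slab.
move=> x /andP[x0 _]; rewrite ler_expR linZ innerZl innerZr u1.
have : 0 <= c * lin u x by rewrite mulr_ge0// ltW.
lra.
Qed.

End gaussian_slabs.

(** * Cells of the largest excess *)

Section nazarov.
Context {R : realType} {p n : nat}.
Variable mu : probability (p.-tuple R) R.
Hypothesis muE : gaussian_rect mu.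
Variables (a : 'I_n -> 'rV[R]_p) (b : 'I_n -> R).
Hypothesis a1 : forall j, inner (a j) (a j) = 1.
Implicit Types (x : p.-tuple R).

Definition excess j x : R := lin (a j) x - b j.

(** The strict inequality breaks ties in favour of the least index, which makes
    the cells disjoint. *)
Definition cell j : set (p.-tuple R) :=
  [set x | forall k, excess k x <= excess j x /\
                     ((k < j)%N -> excess k x < excess j x)].

Definition polytope (t : R) : set (p.-tuple R) :=
  [set x | forall j, lin (a j) x <= b j + t].

Lemma measurable_cell j : measurable (cell j).
Proof.
rewrite (_ : cell j = \bigcap_(k in [set: 'I_n])
    ([set x | excess k x <= excess j x] `&`
     [set x | (k < j)%N ==> (excess k x < excess j x)])); last first.
  apply/seteqP; split => x /=.
    by move=> h k _; have [? hk] := h k; split => //; apply/implyP.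
  by move=> h k; have [? /implyP hk] := h k I; split.
apply: fin_bigcap_measurable => // k _; apply: measurableI.
  rewrite (_ : [set x | _] = [set x | b j - b k <= lin (a j - a k) x]).
    exact: measurable_lin_ge.
  by apply/seteqP; split => x /=; rewrite /excess linB; lra.
case: (k < j)%N => /=; last first.
  by rewrite (_ : [set x | _] = setT)//; apply/seteqP; split.
rewrite (_ : [set x | _] = [set x | b j - b k < lin (a j - a k) x]).
  exact: measurable_lin_gt.
by apply/seteqP; split => x /=; rewrite /excess linB; lra.
Qed.

Lemma trivIset_cell : trivIset setT cell.
Proof.
apply/trivIsetP => i j _ _; wlog ij : i j / (i < j)%N.
  move=> h ne; have [ij|ji|ij] := ltngtP i j; first exact: h.
    by rewrite setIC; apply: h => //; rewrite eq_sym.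
  by case/eqP: ne; exact: val_inj.
move=> _; rewrite -subset0 => x [/= /(_ j)[ji _] /(_ i)[_ /(_ ij)]].
by rewrite ltNge ji.
Qed.

Lemma cell_cover (i0 : 'I_n) x : exists j, cell j x.
Proof.
pose top := [pred j | [forall k, excess k x <= excess j x]].
pose j0 := [arg max_(j > i0) excess j x]%O.
have topj0 : top j0.
  by rewrite /j0; case: arg_maxP => //= j _ h; apply/forallP => k; exact: h.
pose j := [arg min_(j < j0 | top j) (j : nat)].
have [topj jmin] : top j /\ (forall k, top k -> (j <= k)%N).
  by rewrite /j; case: arg_minnP.
exists j => k; split; first exact: (forallP topj).
move=> kj; rewrite ltNge; apply/negP => jk.
have : top k.
  by apply/forallP => l; apply: le_trans jk; exact: (forallP topj).
by move=> /jmin; rewrite leqNgt kj.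
Qed.

(** The translation raises the j-th excess by s and any other by at most s, by
    the Cauchy-Schwarz inequality. *)
Lemma cell_shift j x s : 0 <= s -> cell j x -> cell j (shift (s *: a j) x).
Proof.
move=> s0 cx k.
have inc : s * inner (a k) (a j) <= s by rewrite ler_piMr// inner_le1.
have [h1 h2] := cx k.
rewrite /excess !lin_shift !innerZr a1 mulr1.
move: h1 h2; rewrite /excess => h1 h2; split; first lra.
by move=> /h2; lra.
Qed.

Lemma measurable_polytope t : measurable (polytope t).
Proof.
rewrite (_ : polytope t =
    \bigcap_(j in [set: 'I_n]) [set x | lin (a j) x <= b j + t]).
  by apply: fin_bigcap_measurable => // j _; exact: measurable_lin_le.
by apply/seteqP; split => x /= h j => [_|]; exact: h.
Qed.

(** The cut at level [L] separates a part controlled by the cell from a part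
    controlled by the Gaussian tail. *)
Lemma cell_slab_le j (delta L : R) : 0 < delta -> 0 <= L ->
  pr mu (cell j `&` slab (a j) (b j) delta) <=
  delta * (L + 1) * pr mu (cell j) + expR (- (L ^+ 2 / 2)) * delta.
Proof.
move=> d0 L0; set C := _ `&` _.
have mC : measurable C.
  by apply: measurableI; [exact: measurable_cell|exact: measurable_slab].
have mL := measurable_lin_le L (a j).
rewrite (prDI mu mC mL) addrC; apply: lerD.
  apply: (hazard muE (u := a j)) => //.
  - exact: measurable_cell.
  - exact: measurableI.
  - by move=> x s s0; exact: cell_shift.
  - by move=> x [[]].
  - move=> x y [[_ /andP[_ x2]] _] [[_ /andP[y1 _]] _]; lra.
  - by move=> x [].
(* Above level L, the slab lies in the slab of the same width that starts
   at max (b j) L. *)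
pose c := Num.max (b j) L.
have c0 : 0 <= c by rewrite /c le_max L0 orbT.
apply: (@le_trans _ _ (pr mu (slab (a j) c delta))).
  apply: le_pr; [exact: measurableD|exact: measurable_slab|].
  move=> x [[_ /andP[x1 x2]] /= /negP]; rewrite -ltNge => x3.
  by apply/andP; split; rewrite /c ?gt_max ?x1//; case: (leP (b j) L); lra.
apply: (le_trans (pr_slab muE (a1 j) d0 c0)).
rewrite ler_pM2r// ler_expR lerN2 ler_pM2r//.
by rewrite lerXn2r ?nnegrE// /c le_max lexx orbT.
Qed.

Lemma nazarov (delta : R) : (0 < n)%N -> 0 < delta ->
  pr mu (polytope delta) - pr mu (polytope 0) <=
  delta * (Num.sqrt (2 * ln n%:R) + 2).
Proof.
move=> n0 d0; set L := Num.sqrt _.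
have mP t := measurable_polytope t.
rewrite (prDI mu (mP delta) (mP 0)).
rewrite (_ : polytope delta `&` polytope 0 = polytope 0); last first.
  apply: setIidr => x h j; apply: le_trans (h j) _.
  by rewrite addr0 lerDl ltW.
rewrite addrK.
pose C j := cell j `&` slab (a j) (b j) delta.
have mC j : measurable (C j).
  by apply: measurableI; [exact: measurable_cell|exact: measurable_slab].
apply: (@le_trans _ _ (\sum_(j < n) pr mu (C j))).
  apply: pr_le_sum => //.
  - exact: measurableD.
  - by apply: trivIset_setIr; exact: trivIset_cell.
  move=> x [xd x0]; have [j cj] := cell_cover (Ordinal n0) x.
  exists j; split => //; rewrite /slab /= xd andbT ltNge; apply/negP => xj.
  apply: x0 => k; have [+ _] := cj k.
  by rewrite /excess addr0; lra.
have L2 : L ^+ 2 / 2 = ln n%:R.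
  rewrite sqr_sqrtr; first by rewrite mulrC mulKf.
  by rewrite mulr_ge0// ln_ge0// ler1n.
have eL : expR (- (L ^+ 2 / 2)) = n%:R^-1.
  by rewrite L2 expRN lnK// posrE ltr0n.
apply: (@le_trans _ _ (\sum_(j < n)
    (delta * (L + 1) * pr mu (cell j) + n%:R^-1 * delta))).
  apply: ler_sum => j _; rewrite -eL; apply: cell_slab_le => //.
  exact: sqrtr_ge0.
rewrite big_split /= -mulr_sumr sumr_const card_ord -[_ *+ n]mulr_natl.
rewrite mulVKf ?pnatr_eq0 -?lt0n//.
have cell1 : \sum_(j < n) pr mu (cell j) <= 1.
  apply: le_trans (pr_le1 mu (@measurableT _ _)).
  by apply: sum_pr_le => //; [exact: measurable_cell|exact: trivIset_cell].
have : delta * (L + 1) * \sum_(j < n) pr mu (cell j) <= delta * (L + 1) * 1.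
  by rewrite ler_wpM2l// mulr_ge0 ?ltW// ltr_wpDl// sqrtr_ge0.
lra.
Qed.

End nazarov.

(** * From a Gaussian random vector to its law on tuples *)

Section law.
Context {R : realType} {d : measure_display} {T : measurableType d}
  (P : probability T R) {p : nat} (X : T -> 'rV[R]_p).
Hypothesis hX : standard_gaussian_vector P X.

Definition coords (t : T) : p.-tuple R := [tuple X t 0 i | i < p].

Lemma measurable_coords : measurable_fun [set: T] coords.
Proof.
apply/measurable_fun_tnthP => i.
rewrite (_ : _ \o _ = fun t => X t 0 i); first by case: hX => _ /(_ i)[].
by apply/funext => t /=; rewrite tnth_mktuple.
Qed.

Lemma inner_coords a t : inner a (X t) = lin a (coords t).
Proof. by apply: eq_bigr => i _; rewrite tnth_mktuple. Qed.

Lemma gaussian_law : gaussian_rect (pushforward P coords).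
Proof.
move=> A mA; have [ind std] := hX.
rewrite /pushforward (_ : _ @^-1` _ =
    [set t | forall i, i \in [set: 'I_p]%SET -> A i (X t 0 i)]); last first.
  apply/seteqP; split => t /= h i.
    by move=> _; have := h i; rewrite tnth_mktuple.
  by rewrite tnth_mktuple; apply: h; rewrite finset.in_setT.
rewrite (ind _ _ mA); apply: eq_big => i; first by rewrite finset.in_setT.
by move=> _; have [_ /(_ _ (mA i))] := std i.
Qed.

End law.

Theorem theorem2 (R : realType) (d : measure_display) (T : measurableType d)
    (P : probability T R) (p : nat) (hp : (1 <= p)%N)
    (X : T -> 'rV[R]_p) (hX : standard_gaussian_vector P X)
    (a : 'I_p -> 'rV[R]_p) (ha : forall j, enorm (a j) = 1)
    (b : 'I_p -> R) (delta : R) (hdelta : 0 < delta) :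
  (P [set t | forall j, (inner (a j) (X t) <= b j + delta)%R]
   - P [set t | forall j, (inner (a j) (X t) <= b j)%R]
   <= (delta * (Num.sqrt (2 * ln p%:R) + 2))%:E)%E.
Proof.
pose fX : {mfun T >-> p.-tuple R} :=
  HB.pack (coords X) (isMeasurableFun.Build _ _ _ _ _ (measurable_coords hX)).
pose mu : probability (p.-tuple R) R := distribution P fX.
have muE : gaussian_rect mu := gaussian_law hX.
have a1 j : inner (a j) (a j) = 1 by exact: enorm1_inner.
have PE t : P [set w | forall j, inner (a j) (X w) <= b j + t] =
    (pr mu (polytope a b t))%:E.
  rewrite -EFin_pr; last exact: measurable_polytope.
  congr (P _); apply/seteqP; split => w /= h j; have := h j;
    by rewrite inner_coords.
have := PE 0; under eq_set do under eq_forall do rewrite addr0.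
move=> ->; rewrite PE -EFinB lee_fin.
exact: (nazarov muE b a1).
Qed.
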